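(* Let $\alpha$ be an ordinal and let $M$ be a module over a ring $A$. Then $M$ is $\alpha$-Noetherian if and only if $M$ is Noetherian and $l(M)\le\alpha$.
   Context: The setting is classical (ZFC). All rings have an identity (and need not be commutative), and ''module'' means left module. The symbol $-1$ is regarded as an extra element lying below every ordinal, so $[-1,\alpha)=\{-1\}\cup\{\gamma:\gamma<\alpha\}$. Good lists: let $M$ be a module over a ring $A$. For a finite list $\sigma=[x_0,\ldots,x_{n-1}]$ of elements of $M$ and $x\in M$, write $\sigma.x=[x_0,\ldots,x_{n-1},x]$; $[]$ is the empty list; $\langle x_0,\ldots,x_{k-1}\rangle$ is the submodule of $M$ generated by $x_0,\ldots,x_{k-1}$. - A list $[x_0,\ldots,x_{n-1}]$ is $(-1)$-good (or simply good) if $n\ge 1$ and $x_{n-1}\in\langle x_0,\ldots,x_{n-2}\rangle$. - For an ordinal $\alpha$ (by recursion on $\alpha$), a list $\sigma$ is $\alpha$-good if for every $x\in M$ there exists $\beta\in[-1,\alpha)$ such that $\sigma.x$ is $\beta$-good. - The module $M$ is $\alpha$-Noetherian if the empty list $[]$ of elements of $M$ is $\alpha$-good. Length: let $M$ be a Noetherian module (in the usual sense: ascending chains of submodules stabilize). For a submodule $N\le M$, define an ordinal inductively by $\lambda_M(N):=\sup\{\lambda_M(L)+1 : N\lneq L\le M\}$ (supremum over submodules $L$ of $M$ strictly containing $N$). The length of $M$ is $l(M):=\lambda_M(0)$. *)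

(* Defs.v *)
From HB Require Import structures.
From mathcomp Require Import all_boot all_order all_algebra.
From mathcomp Require Import boolp.
Set Implicit Arguments.
Unset Strict Implicit.
Unset Printing Implicit Defensive.
Import GRing.Theory.
Local Open Scope ring_scope.

(* Ordinals are well-founded trees: [Osup f] denotes the least ordinal strictly
   above all the [f i].  Distinct trees may denote the same ordinal; equality of
   ordinals is [ole a b /\ ole b a].  The lemmas below show that [ole] is a total
   preorder whose strict part [olt] is well founded and has suprema of all
   families, so that the quotient is the class of ordinals of the universe of
   index types (which bounds the universe of the modules used below). *)
Inductive Ord : Type := Osup (I : Type) (f : I -> Ord).

Fixpoint ole (a b : Ord) {struct a} : Prop :=
  let: Osup K f := a in
  forall i : K, let: Osup J g := b in exists j : J, ole (f i) (g j).

Definition olt (a b : Ord) : Prop :=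
  let: Osup J g := b in exists j : J, ole a (g j).

Definition ozero : Ord := Osup (fun e : Empty_set => match e with end).

Definition osucc (a : Ord) : Ord := Osup (fun _ : unit => a).

Definition ochildT (a : Ord) : Type := let: Osup K _ := a in K.

Definition ochild (a : Ord) : ochildT a -> Ord :=
  match a with Osup _ f => f end.

(* Supremum of a family: the elements below it are those below some member. *)
Definition olub (I : Type) (f : I -> Ord) : Ord :=
  Osup (fun p : {i : I & ochildT (f i)} => ochild (projT2 p)).

Lemma ole_refl a : ole a a.
Proof. by elim: a => K f IH /= i; exists i. Qed.

Lemma ole_trans b a c : ole a b -> ole b c -> ole a c.
Proof.
elim: a b c => I f IH [J g] [K h] ab bc i.
by have [j fg] := ab i; have [k gh] := bc j; exists k; apply: IH gh.
Qed.

Lemma ole_olt_trans b a c : ole a b -> olt b c -> olt a c.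
Proof. by case: c => K h ab [k bc]; exists k; apply: ole_trans bc. Qed.

Lemma olt_ole_trans b a c : olt a b -> ole b c -> olt a c.
Proof.
case: b c => J g [K h] [j ag] bc; have [k gh] := bc j.
by exists k; apply: ole_trans gh.
Qed.

Lemma oleP a b : ole a b <-> forall c, olt c a -> olt c b.
Proof.
split=> [ab c ca|]; first exact: olt_ole_trans ab.
case: a b => I f [J g] H i.
by apply: (H (f i)); exists i; exact: ole_refl.
Qed.

Lemma ole_total a b : ole a b \/ olt b a.
Proof.
elim: a b => I f IH b; have [lt_ba|nlt_ba] := EM (olt b (Osup f)).
  by right.
left; case: b nlt_ba => J g nlt_ba i.
have [//|nex] := EM (exists j, ole (f i) (g j)).
case: nlt_ba; exists i => /= j; case: (IH i (g j)) => [le_ij|].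
  by case: nex; exists j.
by [].
Qed.

Lemma olt_wf : well_founded olt.
Proof.
suff H a c : ole c a -> Acc olt c by move=> a; exact: H (ole_refl a).
elim: a c => I f IH c ca; constructor=> d dc.
by have [i] := olt_ole_trans dc ca; exact: IH.
Qed.

Lemma olt_irr a : ~ olt a a.
Proof. by elim: {a}(olt_wf a) => a _ IH aa; exact: (IH a). Qed.

Lemma olt_ole a b : olt a b -> ole a b.
Proof.
elim: a b => K f IH [J g] [j ag] i; exists j; apply: ole_trans ag.
by apply: IH; exists i; exact: ole_refl.
Qed.

Lemma ozero_least a : ole ozero a.
Proof. by case. Qed.

Lemma osucc_le a b : ole (osucc a) b <-> olt a b.
Proof. by case: b => J g; split=> [/(_ tt)|H _]. Qed.

Lemma ole_childP a b : ole a b <-> forall x : ochildT a, olt (ochild x) b.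
Proof. by case: a b => K f [J g]. Qed.

Lemma olub_le I (f : I -> Ord) b : ole (olub f) b <-> forall i, ole (f i) b.
Proof.
split=> [/ole_childP H i|H]; apply/ole_childP.
  by move=> x; exact: (H (existT _ i x)).
by move=> [i x] /=; move/ole_childP: (H i); exact.
Qed.

Section Modules.
Variables (A : pzRingType) (M : lmodType A).

(* A submodule of [M] is an element of the library type [submodClosed M].
   Membership is boolean, which classically is no restriction. *)

Definition gen (s : seq M) (x : M) : Prop :=
  forall N : submodClosed M, {subset s <= N} -> x \in N.

Definition good (s : seq M) : Prop :=
  exists (t : seq M) (x : M), s = rcons t x /\ gen t x.

(* The elements of [-1, a) are coded in [option Ord], with [None] as -1. *)
Definition in_below (a : Ord) (b : option Ord) : Prop :=
  if b is Some c then olt c a else True.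

Fixpoint ord_good_acc (a : Ord) (ha : Acc olt a) (s : seq M) {struct ha} : Prop :=
  forall x : M, good (rcons s x) \/
    exists (b : Ord) (hb : olt b a), ord_good_acc (Acc_inv ha hb) (rcons s x).

Definition ord_good (a : Ord) (s : seq M) : Prop := ord_good_acc (olt_wf a) s.

Definition ext_good (b : option Ord) (s : seq M) : Prop :=
  if b is Some c then ord_good c s else good s.

Lemma ord_goodE a s : ord_good a s <->
  forall x : M, exists b, in_below a b /\ ext_good b (rcons s x).
Proof.
rewrite /ord_good; case: (olt_wf a) => h /=; split=> H x.
  case: (H x) => [gx|[b [hb gb]]]; first by exists None.
  by exists (Some b); rewrite /= /ord_good (Prop_irrelevance (olt_wf b) (h b hb)).
case: (H x) => [[b|]] /= [hb gb]; last by left.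
by right; exists b, hb; rewrite (Prop_irrelevance (h b hb) (olt_wf b)).
Qed.

Definition ord_noetherian (a : Ord) : Prop := ord_good a [::].

Definition noetherian : Prop :=
  forall c : nat -> submodClosed M,
    (forall n, {subset c n <= c n.+1}) ->
    exists n, forall m, (n <= m)%N -> c m =i c n.

(* [sub_gt L N] : the submodule [L] strictly contains [N]. *)
Definition sub_gt (L N : submodClosed M) : Prop :=
  {subset N <= L} /\ ~ {subset L <= N}.

Lemma noetherian_wf : noetherian -> well_founded sub_gt.
Proof.
move=> noeth N; apply: contrapT => nN.
pose T := {L : submodClosed M | ~ Acc sub_gt L}.
have step (L : T) : {L' : T | sub_gt (sval L') (sval L)}.
  apply: cid; case: L => L nL /=; apply: contrapT => nex; apply: nL.
  constructor=> L' gtL; apply: contrapT => nL'; apply: nex.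
  by exists (exist _ L' nL').
pose c n := iter n (fun L => sval (step L)) (exist _ N nN : T).
have gtc n : sub_gt (sval (c n.+1)) (sval (c n)) by exact: svalP (step (c n)).
have [n cn] := noeth (fun n => sval (c n)) (fun n => (gtc n).1).
by case: (gtc n).2 => x; rewrite (cn n.+1).
Qed.

Fixpoint lambda_acc (N : submodClosed M) (hN : Acc sub_gt N) {struct hN} : Ord :=
  olub (fun L : {L : submodClosed M | sub_gt L N} =>
          osucc (lambda_acc (Acc_inv hN (svalP L)))).

Definition lambda (hM : noetherian) (N : submodClosed M) : Ord :=
  lambda_acc (noetherian_wf hM N).

Lemma lambdaE (hM : noetherian) (N : submodClosed M) :
  lambda hM N = olub (fun L : {L : submodClosed M | sub_gt L N} =>
                        osucc (lambda hM (sval L))).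
Proof.
rewrite {1}/lambda; case: (noetherian_wf hM N) => h /=; congr olub.
apply/funext => L; congr osucc; rewrite /lambda; congr lambda_acc.
exact: Prop_irrelevance.
Qed.

Definition zero_pred : M -> bool := fun x => x == 0.

Lemma zero_pred_closed : subsemimod_closed zero_pred.
Proof.
split; [split|].
- by rewrite unfold_in /zero_pred.
- by move=> x y /eqP-> /eqP->; rewrite unfold_in /zero_pred addr0.
- by move=> a x /eqP->; rewrite unfold_in /zero_pred scaler0.
Qed.

Definition zero_sub : submodClosed M :=
  HB.pack zero_pred (GRing.isSubmodClosed.Build A M zero_pred zero_pred_closed).

Lemma zero_subE x : (x \in zero_sub) = (x == 0).
Proof. by []. Qed.

Definition mod_length (hM : noetherian) : Ord := lambda hM zero_sub.

End Modules.

Arguments noetherian {A} M.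
Arguments ord_noetherian {A} M a.
Arguments mod_length {A M} hM.

(* Main.v *)
Require Import Defs.
From HB Require Import structures.
From mathcomp Require Import all_boot all_order all_algebra.
From mathcomp Require Import boolp.

(* A list [s] that is [a]-good controls every submodule [N] containing [s]:
   an element witnessing that [L] strictly contains [N] lies outside the span
   of [s], hence is a legal move to a [b]-good list contained in [L], with
   [b < a].  This yields both the stabilization of chains and
   [lambda N <= a].  Conversely, if [lambda N <= a] for some [N] inside the
   span of [s], every [x] outside that span makes the span of [rcons s x]
   strictly larger than [N], hence of smaller [lambda]. *)

Set Implicit Arguments.
Unset Strict Implicit.
Unset Printing Implicit Defensive.
Import GRing.Theory.
Local Open Scope ring_scope.

Section GoodLists.
Variables (A : pzRingType) (M : lmodType A).
Implicit Types (s : seq M) (N L : submodClosed M).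

(** Submodules have boolean membership, so the proposition [gen s] is turned into a predicate
    classically. *)
Definition span_pred s : M -> bool := fun x => `[< gen s x >].

Lemma span_pred_closed s : subsemimod_closed (span_pred s).
Proof.
split; [split|].
- by apply/asboolP => N _; exact: rpred0.
- move=> x y /asboolP sx /asboolP sy; apply/asboolP => N sN.
  by rewrite rpredD ?sx ?sy.
- move=> a x /asboolP sx; apply/asboolP => N sN.
  by rewrite rpredZ ?sx.
Qed.

Definition span s : submodClosed M :=
  HB.pack (span_pred s)
    (GRing.isSubmodClosed.Build A M (span_pred s) (span_pred_closed s)).

Lemma spanP s x : reflect (gen s x) (x \in span s).
Proof. exact: asboolP. Qed.

Lemma gen_mem s x : x \in s -> gen s x.
Proof. by move=> sx N; apply. Qed.

Lemma gen_sub s t x : {subset s <= t} -> gen s x -> gen t x.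
Proof. by move=> st sx N tN; apply: sx => y /st/tN. Qed.

Lemma good_rcons s x : good (rcons s x) <-> gen s x.
Proof.
split=> [[t [y [/rcons_inj[-> ->]]]] //|sx].
by exists s, x.
Qed.

Lemma subset_rcons s x N :
  {subset s <= N} -> x \in N -> {subset rcons s x <= N}.
Proof. by move=> sN xN y; rewrite mem_rcons inE => /predU1P[->|/sN]. Qed.

(** A move inside the span of [s] is answered by -1, and one outside it never can be, so only the
    latter need an ordinal. *)
Lemma ord_good_rcons a s :
  ord_good a s <->
  forall x, ~ gen s x -> exists2 b, olt b a & ord_good b (rcons s x).
Proof.
rewrite ord_goodE; split=> [H x nsx|H x].
  have [[b|] [/= ba gb]] := H x; first by exists b.
  by case: nsx; apply/good_rcons.
have [sx|/H[b ba gb]] := EM (gen s x); last by exists (Some b).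
by exists None; split=> //; apply/good_rcons.
Qed.

Lemma ord_good_extend a s N x :
  ord_good a s -> {subset s <= N} -> x \notin N ->
  exists2 b, olt b a & ord_good b (rcons s x).
Proof.
move=> /ord_good_rcons gs sN /negP nNx; apply: gs => sx.
by apply: nNx; exact: sx.
Qed.

Lemma sub_gt_ex L N : sub_gt L N -> exists2 x, x \in L & x \notin N.
Proof.
move=> [_ nLN]; apply: contrapT => nex; apply: nLN => x Lx.
by apply: contrapT => /negP nNx; apply: nex; exists x.
Qed.

(** The list and the starting index are left free so that induction on [a] can lengthen the one and
    advance the other. *)
Lemma ord_good_chain a s (c : nat -> submodClosed M) n :
  ord_good a s -> (forall i, {subset c i <= c i.+1}) -> {subset s <= c n} ->
  exists k, forall m, (k <= m)%N -> c m =i c k.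
Proof.
move=> gs ascc.
have mono i j : (i <= j)%N -> {subset c i <= c j}.
  move=> /subnK <-; elim: (j - i)%N => // k IH x /IH; exact: ascc.
elim/(well_founded_ind olt_wf): a s n gs => a IH s n gs sc.
(* Either some later [c m] has an element [x] outside [c n], and induction applies to [rcons s x]
   inside [c m], or the chain is constant from [n] on. *)
have [[m [x nm [mx nx]]]|stab] :=
  EM (exists m, exists2 x, (n <= m)%N & x \in c m /\ x \notin c n).
  have [b ba gb] := ord_good_extend gs sc nx.
  apply: (IH b ba _ m gb); apply: subset_rcons => // y /sc; exact: mono.
exists n => m nm x; apply/idP/idP => [mx|]; last exact: mono.
by apply: contrapT => /negP nx; apply: stab; exists m, x.
Qed.

Lemma ord_noetherian_noetherian a : ord_noetherian M a -> noetherian M.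
Proof. by move=> gM c ascc; apply: (@ord_good_chain a [::] c 0%N). Qed.

Lemma lambda_le (hM : noetherian M) N a :
  ole (lambda hM N) a <-> forall L, sub_gt L N -> olt (lambda hM L) a.
Proof.
rewrite lambdaE olub_le; split=> [H L LN|H [L LN]]; apply/osucc_le.
  exact: (H (exist _ L LN)).
exact: H.
Qed.

Lemma ord_good_lambda (hM : noetherian M) a s N :
  ord_good a s -> {subset s <= N} -> ole (lambda hM N) a.
Proof.
elim/(well_founded_ind olt_wf): a s N => a IH s N gs sN.
apply/lambda_le => L LN; have [x Lx nNx] := sub_gt_ex LN.
have [b ba gb] := ord_good_extend gs sN nNx.
apply: ole_olt_trans (ba); apply: IH gb _ => //.
by apply: subset_rcons => // y /sN; exact: LN.1.
Qed.

Lemma lambda_ord_good (hM : noetherian M) a s N :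
  {subset N <= span s} -> ole (lambda hM N) a -> ord_good a s.
Proof.
elim/(well_founded_ind olt_wf): a s N => a IH s N Ns /lambda_le lt_a.
apply/ord_good_rcons => x nsx.
have gtN : sub_gt (span (rcons s x)) N.
  split=> [y /Ns/spanP sy|sub].
    (* For strictness, an inclusion of the new span in [N] would put [x] in the span of [s]. *)
    by apply/spanP; apply: gen_sub sy => z; rewrite mem_rcons inE orbC => ->.
  apply/nsx/spanP/Ns/sub/spanP/gen_mem.
  by rewrite mem_rcons mem_head.
(* The answer to [x] is the [lambda] of the new span itself, so the induction hypothesis applies
   with equality. *)
have ltb := lt_a _ gtN; exists (lambda hM (span (rcons s x))) => //.
by apply: IH (ole_refl _).
Qed.

End GoodLists.

Theorem theorem4p8 (alpha : Ord) (A : pzRingType) (M : lmodType A) :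
  ord_noetherian M alpha <->
  exists hM : noetherian M, ole (mod_length hM) alpha.
Proof.
split=> [gM|[hM le_alpha]].
  by exists (ord_noetherian_noetherian gM); exact: ord_good_lambda gM _.
(* It remains to see that the zero submodule lies in the span of the empty list. *)
apply: lambda_ord_good le_alpha => x.
by rewrite zero_subE => /eqP ->; exact: rpred0.
Qed.
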